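(* Let $M>0$ and $a,Q\in\mathbb R$ with $a^2+Q^2<M^2$, let $\omega,m\in\mathbb R$, $\lambda>0$, and set $$K(r)=(r^2+a^2)\omega-am,\qquad\Delta(r)=r^2-2Mr+a^2+Q^2,\qquad\mathcal R(r)=K(r)^2-\Delta(r)\lambda,$$ and $r_+=M+\sqrt{M^2-a^2-Q^2}$. Let $r_t>r_+$ satisfy $\mathcal R(r_t)=\mathcal R'(r_t)=0$, and write $K_t=K(r_t)$, $\Delta_t=\Delta(r_t)$. Then $$\lambda=\frac{K_t^2}{\Delta_t}=\frac{2r_t\omega K_t}{r_t-M},\qquad K_t=\frac{2r_t\omega\Delta_t}{r_t-M},$$ and $$\mathcal R''(r_t)=\frac{8r_t\omega^2}{(r_t-M)^2}\Big((r_t-M)^3+M(M^2-a^2-Q^2)\Big)>0.$$ In addition, if $\Omega_+=a/(r_+^2+a^2)$ and $\varpi=\omega-m\Omega_+$, then $$\omega\varpi=\frac{\omega^2(r_t-r_+)}{(r_t-M)(r_+^2+a^2)}\Big(r_t^2+(r_+-3M)r_t+Mr_+\Big)>0.$$ Moreover, for $s=\pm1$, the imaginary part of the separated spin-one radial potential, $$\operatorname{Im}V^{(s)}_{\mathrm{rad}}(r)=-\frac{2s(r-M)K(r)}{\Delta(r)}+4s\omega r,$$ vanishes at the trapped point: $\operatorname{Im}V^{(s)}_{\mathrm{rad}}(r_t)=0$.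
   Context: $\omega$ and $m$ are the stationary and axial frequencies and $\lambda$ the angular/Carter constant of a separated null bicharacteristic of the Kerr–Newman metric; a point $r_t>r_+$ with $\mathcal R(r_t)=\mathcal R'(r_t)=0$ is called a trapped turning point. Primes denote $d/dr$. *)

(* Defs.v *)
From Stdlib Require Import Reals.
From Coquelicot Require Import Coquelicot.

Open Scope R_scope.

Definition Kfun (a omega m r : R) : R := (r ^ 2 + a ^ 2) * omega - a * m.

Definition DeltaKN (M a Q r : R) : R := r ^ 2 - 2 * M * r + a ^ 2 + Q ^ 2.

(* The radial function of a separated null bicharacteristic; it is a polynomial
   in [r], so [Derive] and [Derive_n] are its genuine derivatives everywhere. *)
Definition radialR (M a Q omega m lambda r : R) : R :=
  Kfun a omega m r ^ 2 - DeltaKN M a Q r * lambda.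

Definition r_plus (M a Q : R) : R := M + sqrt (M ^ 2 - a ^ 2 - Q ^ 2).

Definition trapped_turning_point (M a Q omega m lambda r : R) : Prop :=
  r_plus M a Q < r /\
  radialR M a Q omega m lambda r = 0 /\
  Derive (radialR M a Q omega m lambda) r = 0.

(* Angular velocity of the event horizon. *)
Definition Omega_plus (M a Q : R) : R := a / (r_plus M a Q ^ 2 + a ^ 2).

Definition varpi (M a Q omega m : R) : R := omega - m * Omega_plus M a Q.

(* Imaginary part of the separated radial potential of spin weight [s]. *)
Definition Im_Vrad (M a Q omega m s r : R) : R :=
  - (2 * s * (r - M) * Kfun a omega m r / DeltaKN M a Q r) + 4 * s * omega * r.

(* Main.v *)
(* With x = r_t - M and d = r_+ - M = sqrt (M^2 - a^2 - Q^2) one has Delta_t = x^2 - d^2 > 0,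
   so K_t^2 = Delta_t lambda forces K_t <> 0.  Then R'(r_t) = 0 gives
   lambda = 2 r_t omega K_t / x, and cancelling K_t in K_t^2 = Delta_t lambda gives
   K_t = 2 r_t omega Delta_t / x.  Substituting this value of K_t gives the other formulas;
   the last factor of omega varpi is x^2 + d x + 2 M d. *)

Require Import Defs.
From Stdlib Require Import Reals.
From Coquelicot Require Import Coquelicot.
From Stdlib Require Import Lra.

Open Scope R_scope.

Lemma is_derive_radialR (M a Q omega m lambda r : R) :
  is_derive (radialR M a Q omega m lambda) r
    (4 * r * omega * Kfun a omega m r - 2 * (r - M) * lambda).
Proof.
unfold radialR, Kfun, DeltaKN; auto_derive; [easy | ring].
Qed.

Lemma Derive2_radialR (M a Q omega m lambda r : R) :
  Derive_n (radialR M a Q omega m lambda) 2 r =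
  8 * r ^ 2 * omega ^ 2 + 4 * omega * Kfun a omega m r - 2 * lambda.
Proof.
etransitivity.
(* [Derive_n] of order 2 is convertible to [Derive] of the first derivative. The formula for that
   derivative holds at every point, so it may be substituted under the outer [Derive]. *)
{ apply Derive_ext; intros t; apply is_derive_unique, is_derive_radialR. }
apply is_derive_unique; unfold Kfun; auto_derive; [easy | ring].
Qed.

(** Completing the square: the roots of Delta are M ± (r_+ - M). In this form the square root
    disappears, positivity beyond r_+ is visible, and a factor r - r_+ can be split off. *)
Lemma DeltaKN_factor (M a Q r : R) : a ^ 2 + Q ^ 2 <= M ^ 2 ->
  DeltaKN M a Q r = (r - M) ^ 2 - (r_plus M a Q - M) ^ 2.
Proof.
intros h; unfold DeltaKN, r_plus.
replace (M + sqrt (M ^ 2 - a ^ 2 - Q ^ 2) - M)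
  with (sqrt (M ^ 2 - a ^ 2 - Q ^ 2)) by ring.
rewrite pow2_sqrt by lra; ring.
Qed.

Lemma r_plus_gt (M a Q : R) : a ^ 2 + Q ^ 2 < M ^ 2 -> M < r_plus M a Q.
Proof.
intros h; unfold r_plus.
assert (0 < sqrt (M ^ 2 - a ^ 2 - Q ^ 2)) by (apply sqrt_lt_R0; lra).
lra.
Qed.

Lemma trapped_relations (M a Q omega m lambda r : R) :
  a ^ 2 + Q ^ 2 < M ^ 2 -> 0 < lambda ->
  trapped_turning_point M a Q omega m lambda r ->
  lambda = 2 * r * omega * Kfun a omega m r / (r - M) /\
  Kfun a omega m r = 2 * r * omega * DeltaKN M a Q r / (r - M) /\
  0 < DeltaKN M a Q r /\ omega <> 0.
Proof.
intros hsub hl [hr [hR hR']].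
rewrite (is_derive_unique _ _ _ (is_derive_radialR M a Q omega m lambda r)) in hR'.
unfold radialR in hR.
pose proof (r_plus_gt M a Q hsub) as hp.
assert (hD : 0 < DeltaKN M a Q r) by (rewrite DeltaKN_factor by lra; nra).
set (K := Kfun a omega m r) in *; set (D := DeltaKN M a Q r) in *.
assert (hDl : 0 < D * lambda) by now apply Rmult_lt_0_compat.
(* If K vanished, R = 0 would read D lambda = 0. *)
assert (hK : K <> 0) by (intros e; rewrite e in hR; lra).
assert (hlam : lambda = 2 * r * omega * K / (r - M)).
(* Multiplied by r - M > 0, this is half of R' = 0. *)
{ apply Rmult_eq_reg_r with (r - M); [field_simplify; lra | lra]. }
assert (hKeq : K = 2 * r * omega * D / (r - M)).
{ apply Rmult_eq_reg_r with K; [| exact hK].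
  replace (K * K) with (D * lambda) by lra.
  rewrite hlam; field; lra. }
repeat split; try assumption.
(* K is proportional to omega, so omega = 0 would contradict K <> 0; this is what makes the later
   inequalities strict. *)
intros e; apply hK; rewrite hKeq, e; field; lra.
Qed.

Theorem proposition17
  (M a Q : R) (hM : 0 < M) (hsub : a ^ 2 + Q ^ 2 < M ^ 2)
  (omega m lambda : R) (hlambda : 0 < lambda)
  (rt : R) (hrt : trapped_turning_point M a Q omega m lambda rt) :
  let rp := r_plus M a Q in
  let Kt := Kfun a omega m rt in
  let Dt := DeltaKN M a Q rt in
  let R2 := Derive_n (radialR M a Q omega m lambda) 2 rt in
  let w := varpi M a Q omega m in
  (lambda = Kt ^ 2 / Dt /\
   Kt ^ 2 / Dt = 2 * rt * omega * Kt / (rt - M) /\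
   Kt = 2 * rt * omega * Dt / (rt - M)) /\
  (R2 = 8 * rt * omega ^ 2 / (rt - M) ^ 2
        * ((rt - M) ^ 3 + M * (M ^ 2 - a ^ 2 - Q ^ 2)) /\
   0 < R2) /\
  (omega * w = omega ^ 2 * (rt - rp) / ((rt - M) * (rp ^ 2 + a ^ 2))
               * (rt ^ 2 + (rp - 3 * M) * rt + M * rp) /\
   0 < omega * w) /\
  (forall s : R, s = 1 \/ s = -1 -> Im_Vrad M a Q omega m s rt = 0).
Proof.
intros rp Kt Dt R2 w.
destruct (trapped_relations M a Q omega m lambda rt hsub hlambda hrt)
  as [hlam [hK [hD hom]]].
destruct hrt as [hr [hR _]].
pose proof (r_plus_gt M a Q hsub) as hp.
pose proof (DeltaKN_factor M a Q rt (Rlt_le _ _ hsub)) as hDf.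
unfold radialR in hR.
fold rp in hr, hp, hDf; fold Kt in hlam, hK, hR; fold Dt in hK, hD, hDf, hR.
assert (hom2 : 0 < omega ^ 2) by now apply pow2_gt_0.
assert (hA : 0 < rp ^ 2 + a ^ 2) by nra.
assert (hlamD : lambda = Kt ^ 2 / Dt).
{ replace (Kt ^ 2) with (Dt * lambda) by lra; field; lra. }
assert (hR2 : R2 = 8 * rt * omega ^ 2 / (rt - M) ^ 2
                   * ((rt - M) ^ 3 + M * (M ^ 2 - a ^ 2 - Q ^ 2))).
(* With x = r_t - M, the substitutions give 8 r_t omega^2 (r_t x^2 - M Delta_t) / x^2, and r_t x^2 -
   M Delta_t = x^3 + M (M^2 - a^2 - Q^2). *)
{ unfold R2; rewrite Derive2_radialR; fold Kt.
  rewrite hlam, hK; unfold Dt, DeltaKN; field; lra. }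
assert (hw : omega * w = omega ^ 2 * (rt - rp) / ((rt - M) * (rp ^ 2 + a ^ 2))
                         * (rt ^ 2 + (rp - 3 * M) * rt + M * rp)).
(* The frequency m enters only through a m, which K_t determines. Eliminating it leaves omega (K_t -
   (r_t^2 - r_+^2) omega) / (r_+^2 + a^2), and the factored Delta_t in K_t brings out r_t - r_+. *)
{ assert (ham : a * m = (rt ^ 2 + a ^ 2) * omega - Kt) by (unfold Kt, Kfun; ring).
  unfold w, varpi, Omega_plus; fold rp.
  replace (m * (a / (rp ^ 2 + a ^ 2))) with (a * m / (rp ^ 2 + a ^ 2))
    by (field; lra).
  rewrite ham, hK, hDf; field; lra. }
split; [| split; [| split]].
- split; [exact hlamD | split; [rewrite <- hlamD; exact hlam | exact hK]].
- split; [exact hR2 | rewrite hR2].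
  apply Rmult_lt_0_compat.
  + apply Rdiv_lt_0_compat; [nra | apply pow_lt; lra].
  + apply Rplus_lt_0_compat; [apply pow_lt; lra | apply Rmult_lt_0_compat; lra].
- split; [exact hw | rewrite hw].
  apply Rmult_lt_0_compat.
  + apply Rdiv_lt_0_compat; apply Rmult_lt_0_compat; lra.
  + replace (rt ^ 2 + (rp - 3 * M) * rt + M * rp)
      with ((rt - M) ^ 2 + (rp - M) * (rt - M) + 2 * M * (rp - M)) by ring.
    assert (0 < (rp - M) * (rt - M)) by (apply Rmult_lt_0_compat; lra).
    assert (0 < M * (rp - M)) by (apply Rmult_lt_0_compat; lra).
    assert (0 < (rt - M) ^ 2) by (apply pow_lt; lra).
    lra.
(* The formula for K_t says 2 (r_t - M) K_t / Delta_t = 4 r_t omega, so the two terms cancel. *)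
- intros s _; unfold Im_Vrad; fold Kt; fold Dt.
  rewrite hK; field; lra.
Qed.
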